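(* Let $\mathbf{\Sigma}\in\mathbb{R}^{d\times d}$ be symmetric PSD with eigenvalues $\lambda_1>\lambda_2\ge\dots\ge\lambda_d$, eigenvectors $v_1,\dots,v_d$, $\mathrm{gap}=(\lambda_1-\lambda_2)/\lambda_1$, and let $\mathbf{B}=\lambda\mathbf{I}-\mathbf{\Sigma}$ where $\left(1+\frac{\mathrm{gap}}{150}\right)\lambda_1\le\lambda\le\left(1+\frac{\mathrm{gap}}{100}\right)\lambda_1$. Let $x$ be a unit vector with $\langle x,v_1\rangle\neq0$ and let $\tilde x=\mathbf{B}^{-1}x$. Then $$G(\tilde x)\le\frac{\lambda_2(\mathbf{B}^{-1})}{\lambda_1(\mathbf{B}^{-1})}G(x)\le\frac1{100}G(x).$$
   Context: $\|y\|_{\mathbf{B}}=\sqrt{y^\top\mathbf{B}y}$; for $y$ with $v_1^\top y\ne0$, $G(y)=\frac{\|\mathbf{P}_{v_1^\perp}y\|_{\mathbf{B}}}{\|\mathbf{P}_{v_1}y\|_{\mathbf{B}}}$ with $\mathbf{P}_{v_1},\mathbf{P}_{v_1^\perp}$ the orthogonal projections onto $\mathrm{span}(v_1)$ and its orthogonal complement. $\lambda_i(\mathbf{B}^{-1})$ denotes the $i$-th largest eigenvalue of $\mathbf{B}^{-1}$. *)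

(* Defs.v *)
From mathcomp Require Import all_boot all_order all_algebra.
From mathcomp Require Import polyrcf.

Set Implicit Arguments.
Unset Strict Implicit.
Unset Printing Implicit Defensive.

Import Order.TTheory GRing.Theory Num.Theory.
Local Open Scope ring_scope.

(* Vectors are columns. *)
Definition dotv (R : rcfType) (n : nat) (x y : 'cV[R]_n) : R :=
  (x^T *m y) 0 0.

(* The real eigenvalues of A, repeated according to their algebraic
   multiplicity, in non-increasing order (all n eigenvalues when A is
   symmetric). *)
Definition eigvals (R : rcfType) (n : nat) (A : 'M[R]_n) : seq R :=
  let p := char_poly A in
  sort >=%R (flatten [seq nseq (mup a p) a | a <- rootsR p]).

(* Numbered from 0: the i-th largest eigenvalue lambda_i(A) of the usual
   1-based notation is eigval A i.-1. *)
Definition eigval (R : rcfType) (n : nat) (A : 'M[R]_n) (i : nat) : R :=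
  (eigvals A)`_i.

Definition psdmx (R : rcfType) (n : nat) (A : 'M[R]_n) : Prop :=
  A \is symmetricmx /\ (forall y : 'cV[R]_n, 0 <= (y^T *m A *m y) 0 0).

Definition mxnorm (R : rcfType) (n : nat) (B : 'M[R]_n) (y : 'cV[R]_n) : R :=
  Num.sqrt ((y^T *m B *m y) 0 0).

(* Subspaces are row spaces, as in mxalgebra, and proj_mx acts on row vectors;
   hence the transpositions below. *)
Definition orthocompl (R : rcfType) (m n : nat) (U : 'M[R]_(m, n)) : 'M[R]_n :=
  orthomx idfun 1%:M U.

Definition orthoproj (R : rcfType) (m n : nat) (U : 'M[R]_(m, n))
    (y : 'cV[R]_n) : 'cV[R]_n :=
  (y^T *m proj_mx <<U>>%MS (orthocompl U))^T.

(* Meaningful when dotv v y != 0. *)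
Definition Gratio (R : rcfType) (n : nat) (B : 'M[R]_n) (v y : 'cV[R]_n) : R :=
  mxnorm B (orthoproj (orthocompl v^T) y) / mxnorm B (orthoproj v^T y).

Definition gap (R : rcfType) (n : nat) (A : 'M[R]_n) : R :=
  (eigval A 0 - eigval A 1) / eigval A 0.

(* Main.v *)
Require Import Defs.
From mathcomp Require Import all_boot all_order all_algebra.
From mathcomp Require Import polyrcf.
From mathcomp Require Import ring lra.
Import Order.TTheory GRing.Theory Num.Theory.
Local Open Scope ring_scope.

Set Implicit Arguments.
Unset Strict Implicit.

(* In an orthonormal eigenbasis, B^-1 divides the i-th coordinate of x by
   d_i = lambda - lambda_i.  The d_i increase with i, so the coordinates
   orthogonal to v_1 shrink, relative to the first one, by at least the factor
   d_1 / d_2, which is the ratio of the two largest eigenvalues of B^-1.  The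
   choice of lambda gives d_2 = (lambda_1 - lambda_2) + d_1 >= 101 d_1. *)

(** * Root multiplicities and the list of eigenvalues *)

Lemma mup_prod_XsubC (F : fieldType) (s : seq F) (a : F) :
  mup a (\prod_(b <- s) ('X - b%:P)) = count_mem a s.
Proof.
elim: s => [|b s IHs]; first by rewrite big_nil mupNroot // root1.
have p_neq0 : \prod_(c <- s) ('X - c%:P) != 0.
  by rewrite monic_neq0 // monic_prod_XsubC.
rewrite big_cons mupM ?polyXsubC_eq0 // IHs -['X - _]expr1 mup_XsubCX /=.
by case: (b == a).
Qed.

(** Each [a] occurs in both lists as often as its multiplicity in the characteristic polynomial; a
    value that is not a root occurs in neither. *)
Lemma eigvals_perm (R : rcfType) (n : nat) (A : 'M[R]_n) (s : seq R) :
  char_poly A = \prod_(a <- s) ('X - a%:P) -> perm_eq (eigvals A) s.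
Proof.
move=> chA; rewrite /eigvals perm_sort.
apply/allP => a _ /=; rewrite count_flatten -map_comp chA.
set p := \prod_(b <- s) _.
have p_neq0 : p != 0 by rewrite monic_neq0 // monic_prod_XsubC.
have countE b : count_mem a (nseq (mup b p) b) =
    (if b == a then count_mem a s else 0)%N.
  rewrite count_nseq /= eq_sym; case: eqVneq => [->|_]; last by rewrite mul0n.
  by rewrite mul1n mup_prod_XsubC.
have [a_s|aNs] := boolP (a \in rootsR p); last first.
  have aN : a \notin s.
    apply: contra aNs => a_s; rewrite -roots_on_rootsR // root_prod_XsubC.
    by rewrite a_s andbT.
  rewrite (count_memPn aN) sumnE big_map big1_seq // => b /andP[_ b_s] /=.
  by rewrite countE; case: eqP b_s aNs => // -> ->.
rewrite sumnE big_map (bigD1_seq a) ?uniq_roots //= countE eqxx.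
rewrite big1 ?addn0 // => b bNa.
by rewrite countE (negPf bNa).
Qed.

Lemma eigvals_sorted (R : rcfType) (n : nat) (A : 'M[R]_n) :
  sorted >=%R (eigvals A).
Proof. exact: sort_sorted ge_total _. Qed.

(** * Matrices with an orthonormal eigenbasis *)

Section Eigenbasis.

Variables (R : rcfType) (n : nat) (v : 'I_n -> 'cV[R]_n).
Hypothesis v_orthonormal : forall i j, dotv (v i) (v j) = (i == j)%:R.

Let V := \matrix_(k, i) v i k 0.

Let colV i : col i V = v i.
Proof. by apply/colP => k; rewrite !mxE. Qed.

Let VtE (y : 'cV[R]_n) i : (V^T *m y) i 0 = dotv (v i) y.
Proof. by rewrite /dotv !mxE; apply: eq_bigr => k _; rewrite !mxE. Qed.

Let VtV : V^T *m V = 1%:M.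
Proof.
apply/matrixP => i j; rewrite [RHS]mxE -v_orthonormal -VtE -[v j]colV.
by rewrite colE mulmxA -colE [RHS]mxE.
Qed.

Let VVt : V *m V^T = 1%:M.
Proof. exact: mulmx1C VtV. Qed.

Variables (A : 'M[R]_n) (d : 'I_n -> R).
Hypothesis A_eigen : forall i, A *m v i = d i *: v i.

Let AV : A *m V = V *m diag_mx (\row_i d i).
Proof.
apply/matrixP => k i; rewrite mul_mx_diag !mxE.
have /matrixP/(_ k 0) := A_eigen i; rewrite !mxE mulrC => <-.
by apply: eq_bigr => j _; rewrite !mxE.
Qed.

(** The matrix [V] with columns [v i] is orthogonal and diagonalizes [A]. Over polynomials, [P] is
    [V] with constant entries, and conjugating [char_poly_mx A] by it keeps the determinant because
    [P^T *m P] is the identity. *)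
Lemma char_poly_eigenbasis : char_poly A = \prod_i ('X - (d i)%:P).
Proof.
have simA : V^T *m A *m V = diag_mx (\row_i d i).
  by rewrite -mulmxA AV mulmxA VtV mul1mx.
have -> : \prod_i ('X - (d i)%:P) = char_poly (V^T *m A *m V).
  rewrite simA char_poly_trig ?diag_mx_is_trig //.
  by apply: eq_bigr => i _; rewrite !mxE eqxx.
set P := map_mx (@polyC R) V.
have PtP : P^T *m P = 1%:M by rewrite map_trmx -map_mxM VtV map_mx1.
have -> : char_poly (V^T *m A *m V) = \det (P^T *m char_poly_mx A *m P).
  congr (\det _); rewrite /char_poly_mx mulmxBr mulmxBl !map_mxM -map_trmx.
  by rewrite mul_mx_scalar -scalemxAl PtP scalemx1.
by rewrite !det_mulmx mulrAC -det_mulmx PtP det1 mul1r.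
Qed.

Lemma eigvals_eigenbasis_perm : perm_eq (eigvals A) [seq d i | i <- enum 'I_n].
Proof.
by apply: eigvals_perm; rewrite char_poly_eigenbasis big_map big_enum.
Qed.

Lemma eigvals_eigenbasis :
  sorted >=%R [seq d i | i <- enum 'I_n] ->
  eigvals A = [seq d i | i <- enum 'I_n].
Proof.
move=> sd; apply: (sorted_eq _ _ (eigvals_sorted _)) => //.
- exact: ge_trans.
- exact: ge_anti.
- exact: eigvals_eigenbasis_perm.
Qed.

(** Multiplying [AV] by [V^T] on both sides shows that the [v i] are also left eigenvectors. *)
Lemma dotv_mul_eigenbasis (y : 'cV[R]_n) i :
  dotv (v i) (A *m y) = d i * dotv (v i) y.
Proof.
have VtA : V^T *m A = diag_mx (\row_i d i) *m V^T.
  by rewrite -[A]mulmx1 -VVt (mulmxA A) AV !mulmxA VtV mul1mx.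
by rewrite -!VtE mulmxA VtA -mulmxA mul_diag_mx [LHS]mxE mxE.
Qed.

(** Up to sign, the determinant is the characteristic polynomial at 0, a product of the nonzero
    numbers [- d i]. *)
Lemma unitmx_eigenbasis : (forall i, d i != 0) -> A \in unitmx.
Proof.
move=> d_neq0; rewrite unitmxE unitfE; apply: contraTneq isT => detA0.
have := char_poly_det A; rewrite detA0 mulr0 -horner_coef0 char_poly_eigenbasis.
rewrite horner_prod => /eqP; rewrite prodf_seq_eq0 => /hasP[i _ /=].
by rewrite hornerXsubC sub0r oppr_eq0 (negPf (d_neq0 i)).
Qed.

Lemma invmx_eigenbasis : (forall i, d i != 0) ->
  forall i, invmx A *m v i = (d i)^-1 *: v i.
Proof.
move=> d_neq0 i; apply: (scalerI (d_neq0 i)).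
rewrite scalerA divff // scale1r scalemxAr -A_eigen mulmxA mulVmx ?mul1mx //.
exact: unitmx_eigenbasis.
Qed.

Lemma quadform_eigenbasis (y : 'cV[R]_n) :
  (y^T *m A *m y) 0 0 = \sum_i d i * dotv (v i) y ^+ 2.
Proof.
have -> : y^T *m A *m y = (V^T *m y)^T *m (diag_mx (\row_i d i) *m (V^T *m y)).
  rewrite trmx_mul trmxK -[y^T *m V *m _]mulmxA !(mulmxA V) -AV.
  by rewrite -mulmxA -(mulmxA A) (mulmxA V) VVt mul1mx.
rewrite mxE; apply: eq_bigr => i _.
by rewrite mul_diag_mx [_^T _ _]mxE [(\matrix_(_, _) _) _ _]mxE !VtE !mxE; ring.
Qed.

End Eigenbasis.

(** * Orthogonal projections onto a line and onto its complement *)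

Section OrthogonalProjection.

Variables (R : rcfType) (n : nat).

Lemma sub_orthocompl (m p : nat) (W : 'M[R]_(p, n)) (U : 'M[R]_(m, n)) :
  (W <= orthocompl U)%MS = (W *m U^T == 0).
Proof. by rewrite /orthocompl /orthomx mul1mx map_mx_id // sub_kermx. Qed.

Lemma dotv_eq0 (y : 'cV[R]_n) : dotv y y = 0 -> y = 0.
Proof.
rewrite /dotv mxE => /eqP; rewrite psumr_eq0 => [/allP y0|i _]; last first.
  by rewrite mxE -expr2 sqr_ge0.
apply/colP => i; have := y0 i; rewrite mem_index_enum => /(_ isT) /=.
by rewrite !mxE -expr2 sqrf_eq0 => /eqP.
Qed.

(** A vector in both spaces is orthogonal to itself. This directness is what makes [proj_mx] behave
    as a projection. *)
Lemma capmx_orthocompl (m : nat) (U : 'M[R]_(m, n)) :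
  (<<U>> :&: orthocompl U)%MS = 0.
Proof.
apply/eqP; rewrite -submx0; apply/rV_subP => u.
rewrite sub_capmx genmxE sub_orthocompl submx0 => /andP[/submxP[w uE] /eqP uU0].
have : dotv u^T u^T = 0.
  by rewrite /dotv trmxK {2}uE trmx_mul mulmxA uU0 mul0mx mxE.
by move/dotv_eq0/(congr1 trmx); rewrite trmxK trmx0 => ->.
Qed.

(** Any splitting along [U] and its complement determines the projection. Both formulas below apply
    this to y = <v,y> v + (y - <v,y> v), with the roles of the two terms exchanged. *)
Lemma orthoproj_add (m : nat) (U : 'M[R]_(m, n)) (p q : 'cV[R]_n) :
  (p^T <= U)%MS -> (q^T <= orthocompl U)%MS -> orthoproj U (p + q) = p.
Proof.
move=> pU qU; rewrite /orthoproj linearD /= mulmxDl.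
rewrite proj_mx_id ?genmxE ?capmx_orthocompl //.
by rewrite proj_mx_0 ?capmx_orthocompl // addr0 trmxK.
Qed.

Variable (v : 'cV[R]_n).
Hypothesis v_unit : dotv v v = 1.

Let residual_sub (y : 'cV[R]_n) :
  ((y - dotv v y *: v)^T <= orthocompl v^T)%MS.
Proof.
rewrite sub_orthocompl trmxK linearB linearZ /= mulmxBl -scalemxAl.
rewrite [v^T *m v]mx11_scalar -/(dotv v v) v_unit scalemx1.
rewrite [y^T *m v]mx11_scalar -[y^T *m v]trmxK trmx_mul trmxK mxE.
by rewrite -/(dotv v y) subrr.
Qed.

Lemma orthoproj_unit (y : 'cV[R]_n) : orthoproj v^T y = dotv v y *: v.
Proof.
rewrite -{1}[y](subrKC (dotv v y *: v)) orthoproj_add //.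
by rewrite linearZ /= scalemx_sub.
Qed.

Lemma orthoproj_orthocompl_unit (y : 'cV[R]_n) :
  orthoproj (orthocompl v^T) y = y - dotv v y *: v.
Proof.
rewrite -{1}[y](subrK (dotv v y *: v)) orthoproj_add //.
rewrite linearZ /= scalemx_sub // sub_orthocompl.
(* Read through [sub_orthocompl], reflexivity says that the complement annihilates [v]; transposing
   puts [v] in the double complement. *)
have : (orthocompl v^T <= orthocompl v^T)%MS by [].
rewrite sub_orthocompl trmxK => /eqP cv0.
by rewrite -trmx_mul cv0 trmx0.
Qed.

End OrthogonalProjection.

(** * The ratio G in eigencoordinates *)

Lemma dotvBr (R : rcfType) (n : nat) (u y z : 'cV[R]_n) :
  dotv u (y - z) = dotv u y - dotv u z.
Proof. by rewrite /dotv mulmxBr !mxE. Qed.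

Lemma dotvZr (R : rcfType) (n : nat) (u y : 'cV[R]_n) (a : R) :
  dotv u (a *: y) = a * dotv u y.
Proof. by rewrite /dotv -scalemxAr mxE. Qed.

(** Subtracting the projection kills coordinate [k] and keeps the others, so the diagonal quadratic
    form splits between the two norms. *)
Lemma Gratio_eigenbasis (R : rcfType) (n : nat) (v : 'I_n -> 'cV[R]_n)
    (B : 'M[R]_n) (d : 'I_n -> R) (k : 'I_n) (y : 'cV[R]_n) :
  (forall i j, dotv (v i) (v j) = (i == j)%:R) ->
  (forall i, B *m v i = d i *: v i) ->
  Gratio B (v k) y =
    Num.sqrt (\sum_(i | i != k) d i * dotv (v i) y ^+ 2)
      / Num.sqrt (d k * dotv (v k) y ^+ 2).
Proof.
move=> vo Bv; have vk1 : dotv (v k) (v k) = 1 by rewrite vo eqxx.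
rewrite /Gratio /mxnorm orthoproj_orthocompl_unit // orthoproj_unit //.
rewrite !(quadform_eigenbasis vo Bv).
congr (Num.sqrt _ / Num.sqrt _); rewrite (bigD1 k) //= ?dotvBr ?dotvZr vk1.
  rewrite mulr1 subrr expr0n mulr0 add0r; apply: eq_bigr => i iNk.
  by rewrite dotvBr dotvZr vo (negPf iNk) mulr0 subr0.
rewrite mulr1 big1 ?addr0 // => i iNk.
by rewrite dotvZr vo (negPf iNk) mulr0 expr0n mulr0.
Qed.

Lemma Gratio_ge0 (R : rcfType) (n : nat) (B : 'M[R]_n) (v y : 'cV[R]_n) :
  0 <= Gratio B v y.
Proof. by rewrite divr_ge0 ?sqrtr_ge0. Qed.

(** Since [d l] bounds the [d i] off [k] from below, [invmx B] divides the numerator of G by at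
    least [d l], and its denominator by exactly [d k]. *)
Lemma Gratio_invmx_le (R : rcfType) (n : nat) (v : 'I_n -> 'cV[R]_n)
    (B : 'M[R]_n) (d : 'I_n -> R) (k l : 'I_n) (x : 'cV[R]_n) :
  (forall i j, dotv (v i) (v j) = (i == j)%:R) ->
  (forall i, B *m v i = d i *: v i) ->
  (forall i, 0 < d i) -> (forall i, i != k -> d l <= d i) ->
  Gratio B (v k) (invmx B *m x) <= d k / d l * Gratio B (v k) x.
Proof.
move=> vo Bv d_gt0 d_min.
have d_ge0 i : 0 <= d i by rewrite ltW.
have dV_ge0 i : 0 <= (d i)^-1 by rewrite invr_ge0.
have d_neq0 i : d i != 0 by rewrite gt_eqF.
have xtE i : dotv (v i) (invmx B *m x) = (d i)^-1 * dotv (v i) x.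
  by rewrite (dotv_mul_eigenbasis vo (invmx_eigenbasis vo Bv d_neq0)).
rewrite !(Gratio_eigenbasis k _ vo Bv).
set S := \sum_(i | _) _ * dotv _ x ^+ 2; set S' := \sum_(i | _) _.
set t := d k * dotv (v k) x ^+ 2.
have S'_le : Num.sqrt S' <= (d l)^-1 * Num.sqrt S.
  (* The factor enters the square root as its square, so that the sums can be compared term by
     term. *)
  rewrite -[(d l)^-1]ger0_norm // -sqrtr_sqr -sqrtrM ?sqr_ge0 //.
  apply: ler_wsqrtr; rewrite mulr_sumr; apply: ler_sum => i iNk.
  rewrite xtE exprMn [leLHS]mulrA [leRHS]mulrA ler_wpM2r ?sqr_ge0 //.
  rewrite mulrC ler_wpM2r // lerXn2r ?nnegrE //.
  by rewrite lef_pV2 ?posrE ?d_min.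
have -> : d k * dotv (v k) (invmx B *m x) ^+ 2 = (d k)^-1 ^+ 2 * t.
  by rewrite xtE exprMn /t; ring.
rewrite sqrtrM ?sqr_ge0 // sqrtr_sqr ger0_norm // invfM invrK.
rewrite [leLHS]mulrC [leRHS](_ : _ =
  d k * (Num.sqrt t)^-1 * ((d l)^-1 * Num.sqrt S)); last by ring.
by rewrite ler_wpM2l // mulr_ge0 ?invr_ge0 ?sqrtr_ge0.
Qed.

Theorem theorem3p4 (R : rcfType) (n : nat) (Sigma : 'M[R]_n.+2)
    (v : 'I_n.+2 -> 'cV[R]_n.+2) (lambda : R) (x : 'cV[R]_n.+2)
    (Sigma_psd : psdmx Sigma)
    (Sigma_gap : eigval Sigma 1 < eigval Sigma 0)
    (v_eigen : forall i, Sigma *m v i = eigval Sigma i *: v i)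
    (v_orthonormal : forall i j, dotv (v i) (v j) = (i == j)%:R)
    (lambda_lb : (1 + gap Sigma / 150) * eigval Sigma 0 <= lambda)
    (lambda_ub : lambda <= (1 + gap Sigma / 100) * eigval Sigma 0)
    (x_unit : dotv x x = 1)
    (x_v1 : dotv x (v ord0) != 0) :
  let B := lambda%:M - Sigma in
  let xt := invmx B *m x in
  let ratio := eigval (invmx B) 1 / eigval (invmx B) 0 in
  Gratio B (v ord0) xt <= ratio * Gratio B (v ord0) x /\
  ratio * Gratio B (v ord0) x <= 1 / 100 * Gratio B (v ord0) x.
Proof.
set e := eigval Sigma; set L := lambda => B.
(* The permutation serves to count the eigenvalues: below [n.+2], no index reaches the default 0 of
   [nth]. *)
have e_perm := eigvals_eigenbasis_perm v_orthonormal v_eigen.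
have size_eigs : size (eigvals Sigma) = n.+2.
  by rewrite (perm_size e_perm) size_map size_enum_ord.
have e_mono (i j : nat) : (i <= j < n.+2)%N -> e j <= e i.
  move=> /andP[ij jn].
  apply: (sorted_leq_nth ge_trans ge_refl 0 (eigvals_sorted Sigma)) => //.
    by rewrite inE size_eigs (leq_ltn_trans ij).
  by rewrite inE size_eigs.
(* Semidefiniteness is tested on v_2, of index [lift ord0 ord0], where the form equals lambda_2. *)
have e1_ge0 : 0 <= e 1%N.
  case: Sigma_psd => _ /(_ (v (lift ord0 ord0))).
  by rewrite -mulmxA v_eigen -scalemxAr mxE -/(dotv _ _) v_orthonormal mulr1.
have e0_gt0 : 0 < e 0%N by apply: le_lt_trans Sigma_gap.
(* Multiplying by lambda_1 > 0 clears the denominator of the gap; the bounds on lambda become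
   linear, within reach of [lra]. *)
have gapE c : (1 + gap Sigma / c) * e 0%N = e 0%N + (e 0%N - e 1%N) / c.
  by rewrite /gap -/e mulrDl mul1r mulrAC divfK ?gt_eqF.
pose d (i : 'I_n.+2) := L - e i.
have Bv i : B *m v i = d i *: v i.
  by rewrite /B mulmxBl mul_scalar_mx v_eigen scalerBl.
move: lambda_lb lambda_ub Sigma_gap; rewrite !gapE -/L -/(e 0%N) -/(e 1%N).
move=> L_lb L_ub e_gap.
(* The lower bound gives L - lambda_1 >= (lambda_1 - lambda_2) / 150 > 0. *)
have d0_gt0 : 0 < L - e 0%N by lra.
have d_mono (i j : 'I_n.+2) : (i <= j)%N -> d i <= d j.
  by move=> ij; rewrite lerB // e_mono // ij ltn_ord.
have d_gt0 i : 0 < d i.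
  by apply: lt_le_trans d0_gt0 _; exact: (d_mono ord0).
have d_neq0 i : d i != 0 by rewrite gt_eqF.
have invB_eigvals : eigvals (invmx B) = [seq (d i)^-1 | i <- enum 'I_n.+2].
  have invBv := invmx_eigenbasis v_orthonormal Bv d_neq0.
  apply: (eigvals_eigenbasis v_orthonormal invBv).
  (* The enumeration is increasing in the index and 1 / d_i is non-increasing in it, so the list is
     already sorted. *)
  rewrite sorted_map; apply: (@sub_sorted _ (relpre val leq)).
    by move=> i j /= ij; rewrite lef_pV2 ?posrE // d_mono.
  by rewrite -sorted_map val_enum_ord iota_sorted.
have invB_eigval (i : 'I_n.+2) : eigval (invmx B) i = (d i)^-1.
  rewrite /eigval invB_eigvals (nth_map i) ?size_enum_ord //.
  by rewrite nth_ord_enum.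
pose i1 : 'I_n.+2 := lift ord0 ord0.
have -> : eigval (invmx B) 1 / eigval (invmx B) 0 = d ord0 / d i1.
  by rewrite (invB_eigval i1) (invB_eigval ord0) invrK mulrC.
move=> xt ratio; split.
  apply: Gratio_invmx_le => // i iN0; apply: d_mono.
  by rewrite /= /bump /= lt0n.
(* It remains to see 100 d_1 <= d_2: the upper bound on lambda gives 100 d_1 <= lambda_1 - lambda_2,
   which is d_2 - d_1. *)
rewrite ler_wpM2r ?Gratio_ge0 // /ratio ler_pdivrMr //.
by rewrite /d /= /bump /=; lra.
Qed.
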